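(* Consider the patterns of length $3$, i.e. the six permutations $123,132,213,231,312,321\in S_3$. Then: (i) For the statistic $\mathrm{nes}$, the $\mathrm{nes}$-Wilf-equivalence classes of $S_3$ having more than one element are exactly $\{132,213\}$ and $\{231,312\}$ (all other patterns form singleton classes). (ii) For the statistic $\mathrm{crs}$, the only $\mathrm{crs}$-Wilf-equivalence class of $S_3$ having more than one element is $\{132,213,321\}$. (iii) For the pair of statistics $(\mathrm{crs},\mathrm{nes})$, the only $(\mathrm{crs},\mathrm{nes})$-Wilf-equivalence class of $S_3$ having more than one element is $\{132,213\}$.
   Context: $S_n$ is the set of permutations of $[n]=\{1,\dots,n\}$, written $\sigma=\sigma(1)\cdots\sigma(n)$. For a sequence of distinct integers, its reduction $\mathrm{red}$ is the permutation of $[k]$ in the same relative order. $\sigma\in S_n$ contains $\tau\in S_k$ if some subsequence $\sigma(i_1)\cdots\sigma(i_k)$, $i_1<\dots<i_k$, has reduction $\tau$; otherwise $\sigma$ avoids $\tau$. $S_n(T)$ is the set of permutations of $[n]$ avoiding every pattern in $T$. A crossing of $\sigma$ is a pair $(i,j)$ with $i<j<\sigma(i)<\sigma(j)$ or $\sigma(i)<\sigma(j)\le i<j$; a nesting is a pair $(i,j)$ with $i<j<\sigma(j)<\sigma(i)$ or $\sigma(j)<\sigma(i)\le i<j$. $\mathrm{crs}(\sigma)$ and $\mathrm{nes}(\sigma)$ denote the numbers of crossings and nestings. For statistics $\mathrm{st}_1,\dots,\mathrm{st}_k$, two sets of patterns $T,T'$ are $(\mathrm{st}_1,\dots,\mathrm{st}_k)$-Wilf-equivalent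 if for every $n\ge 1$, $\sum_{\sigma\in S_n(T)}\prod_i x_i^{\mathrm{st}_i(\sigma)}=\sum_{\sigma\in S_n(T')}\prod_i x_i^{\mathrm{st}_i(\sigma)}$. Classes here are the equivalence classes of this relation restricted to single patterns $\{\tau\}$, $\tau\in S_3$. *)

(* Defs.v *)
From HB Require Import structures.
From mathcomp Require Import all_boot all_order all_fingroup all_algebra.
From mathcomp Require Import mpoly.

Set Implicit Arguments.
Unset Strict Implicit.
Unset Printing Implicit Defensive.

Import GRing.Theory.

(* The permutations of [n] are 'S_n, acting on {0, ..., n-1}. One-line words
   are written with values in {1, ..., n}. *)
Definition word n (s : 'S_n) : seq nat := [seq (s i).+1 | i <- enum 'I_n].

(* Meaningful for sequences of distinct integers only: each entry is replaced
   by its rank. *)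
Definition red (w : seq nat) : seq nat :=
  [seq (count (fun y => y < x) w).+1 | x <- w].

Definition contains n k (s : 'S_n) (t : 'S_k) : bool :=
  [exists f : {ffun 'I_k -> 'I_n},
     [forall a : 'I_k, forall b : 'I_k, (a < b) ==> (f a < f b)]
     && (red [seq (s (f a)).+1 | a <- enum 'I_k] == word t)].

Definition avoids n k (s : 'S_n) (t : 'S_k) : bool := ~~ contains s t.

Definition pattern := {k : nat & 'S_k}.

Definition Pattern k (t : 'S_k) : pattern := existT (fun k => 'S_k) k t.

(* A set of patterns is given by a list; only its elements matter. *)
Definition Av n (T : seq pattern) : {set 'S_n} :=
  [set s : 'S_n | all (fun t : pattern => avoids s (tagged t)) T].

(* The conditions below only compare positions with values, so they do not
   depend on whether both are numbered from 0 or from 1. *)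
Definition crossing n (s : 'S_n) (i j : 'I_n) : bool :=
  [&& i < j, j < s i & s i < s j] || [&& s i < s j, s j <= i & i < j].

Definition nesting n (s : 'S_n) (i j : 'I_n) : bool :=
  [&& i < j, j < s j & s j < s i] || [&& s j < s i, s i <= i & i < j].

Definition statistic := forall n, 'S_n -> nat.

Definition crs : statistic := fun n s =>
  #|[set p : 'I_n * 'I_n | crossing s p.1 p.2]|.

Definition nes : statistic := fun n s =>
  #|[set p : 'I_n * 'I_n | nesting s p.1 p.2]|.

Definition genpoly m (st : m.-tuple statistic) n (T : seq pattern)
    : {mpoly int[m]} :=
  (\sum_(s in Av n T) \prod_(i < m) 'X_i ^+ tnth st i n s)%R.

Definition wilf_equiv m (st : m.-tuple statistic) (T T' : seq pattern) : Prop :=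
  forall n, 0 < n -> genpoly st n T = genpoly st n T'.

Definition is_wilf_class m (st : m.-tuple statistic) k (C : {set 'S_k}) : Prop :=
  exists t : 'S_k, forall t' : 'S_k,
    t' \in C <-> wilf_equiv st [:: Pattern t] [:: Pattern t'].

(* The permutation with one-line word w; the identity if w is not the word of
   a permutation. *)
Definition perm_of_word n (w : seq nat) : 'S_n.+1 :=
  insubd (1%g : 'S_n.+1) [ffun i : 'I_n.+1 => inord (nth 0 w i).-1].

Definition p123 : 'S_3 := perm_of_word 2 [:: 1; 2; 3].
Definition p132 : 'S_3 := perm_of_word 2 [:: 1; 3; 2].
Definition p213 : 'S_3 := perm_of_word 2 [:: 2; 1; 3].
Definition p231 : 'S_3 := perm_of_word 2 [:: 2; 3; 1].
Definition p312 : 'S_3 := perm_of_word 2 [:: 3; 1; 2].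
Definition p321 : 'S_3 := perm_of_word 2 [:: 3; 2; 1].

Lemma word_perm_of_word n (w : seq nat) :
  perm_eq w (iota 1 n.+1) -> word (perm_of_word n w) = w.
Proof.
move=> pw; have sw : size w = n.+1 by rewrite (perm_size pw) size_iota.
have uw : uniq w by rewrite (perm_uniq pw) iota_uniq.
have wlt (i : 'I_n.+1) : 0 < nth 0 w i <= n.+1.
  by have := mem_nth 0 (s := w) (n := i); rewrite sw ltn_ord => /(_ isT);
     rewrite (perm_mem pw) mem_iota add1n ltnS.
have inordK' (i : 'I_n.+1) : (inord (nth 0 w i).-1 : 'I_n.+1).+1 = nth 0 w i.
  by case/andP: (wlt i) => w0 wn; rewrite inordK prednK.
have inj : injectiveb [ffun i : 'I_n.+1 => inord (nth 0 w i).-1 : 'I_n.+1].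
  apply/injectiveP => i j; rewrite !ffunE => /(congr1 (fun x : 'I_n.+1 => x.+1)).
  rewrite !inordK' => /eqP; rewrite nth_uniq ?sw //.
  by move=> /eqP /val_inj.
apply: (@eq_from_nth _ 0); first by rewrite size_map size_enum_ord.
move=> k; rewrite size_map size_enum_ord => kn.
rewrite (nth_map ord0) ?size_enum_ord // /perm_of_word.
have -> : nth ord0 (enum 'I_n.+1) k = Ordinal kn.
  by apply: val_inj; rewrite /= nth_enum_ord.
have -> : insubd (1%g : 'S_n.+1) [ffun i : 'I_n.+1 => inord (nth 0 w i).-1]
    = Perm inj by apply: val_inj; rewrite insubdK.
by rewrite -pvalE /= ffunE inordK'.
Qed.

Lemma words_S3 :
  [/\ word p123 = [:: 1; 2; 3], word p132 = [:: 1; 3; 2],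
      word p213 = [:: 2; 1; 3] & word p231 = [:: 2; 3; 1]] /\
  word p312 = [:: 3; 1; 2] /\ word p321 = [:: 3; 2; 1].
Proof. by do ![split]; apply: word_perm_of_word. Qed.

(* Main.v *)
Require Import Defs.
From HB Require Import structures.
From mathcomp Require Import all_boot all_order all_fingroup all_algebra.
From mathcomp Require Import mpoly zify.

(** The reverse-complement-inverse of a permutation has the same numbers of
    crossings and nestings, and exchanges 132 and 213; inversion preserves
    nestings and exchanges 231 and 312.  Inequivalent patterns are already
    separated by S_4.

    The deep equivalence is 132 ~ 321 for crossings.  Every permutation satisfies
    crs + inv + exc = sum_i |s(i) - i|, so crs is the sum over the points of the
    diagram of |s(i) - i| - [s(i) > i], minus the number of inversions, and it
    behaves well when points are deleted one at a time.  On both sides, points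
    are deleted along a decision process whose successive choices form a Dyck path
    of length 2n, a down step from height H contributing (H-1)/2 (rounded down)
    to crs.  For 321 the rows and columns are read from the first one on.  For 132
    they are read in the order in which the zigzag bijection of Elizalde and Pak
    reads the Dyck path bounding the diagram, alternately from its two ends; this
    moves the diagonal with respect to which excedances are counted. *)

Set Implicit Arguments.
Unset Strict Implicit.
Unset Printing Implicit Defensive.

Import GRing.Theory Num.Theory.

(** * Crossings, inversions, excedances *)

Lemma sum_ord_in_Ico n a b : b <= n -> \sum_(j < n) ((a <= j) && (j < b)) = b - a.
Proof.
move=> le_bn; rewrite -[in RHS](minn_idPl le_bn).
by elim: n {le_bn} => [|n IHn]; rewrite ?big_ord0 ?big_ord_recr /= ?IHn; lia.
Qed.

Lemma sum_ord_in_Ioc n a b : b < n -> \sum_(j < n) ((a < j) && (j <= b)) = b - a.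
Proof. by move=> lt_bn; rewrite -[RHS]subSS -(sum_ord_in_Ico a.+1 lt_bn). Qed.

Definition ninv n (s : 'S_n) : nat := \sum_(i < n) \sum_(j < n) ((i < j) && (s j < s i)).

Definition nexc n (s : 'S_n) : nat := \sum_(i < n) (i < s i).

Lemma card_pairE n (P : 'I_n -> 'I_n -> bool) :
  #|[set p : 'I_n * 'I_n | P p.1 p.2]| = \sum_i \sum_j P i j.
Proof.
rewrite cardsE -sum1_card big_mkcond pair_big /=.
by apply: eq_bigr => -[i j] _; rewrite unfold_in /=; case: (P i j).
Qed.

(** Doubling either side adds its transpose to it, so only the joint contribution of $(i,j)$ and
    $(j,i)$ matters. *)
Lemma sum_symmetrize n (f g : 'I_n -> 'I_n -> nat) :
  (forall i, f i i = g i i) ->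
  (forall i j : 'I_n, i < j -> f i j + f j i = g i j + g j i) ->
  \sum_i \sum_j f i j = \sum_i \sum_j g i j.
Proof.
move=> fgii fgij; apply: double_inj; rewrite -!addnn.
rewrite [X in _ + X = _]exchange_big [X in _ = _ + X]exchange_big -!big_split /=.
apply: eq_bigr => i _; rewrite -!big_split; apply: eq_bigr => j _ /=.
case: (ltngtP (i : nat) j) => [/fgij->|/fgij e|/val_inj->] //; last by rewrite fgii.
by rewrite addnC e addnC.
Qed.

Lemma perm_val_neq n (s : 'S_n) (i j : 'I_n) : (i == j :> nat) = false -> s i != s j :> nat.
Proof. by move/negbT; apply: contra => /eqP/val_inj/perm_inj->. Qed.

(* Summed over all [j] both sides agree by reindexing along [s], and so do the
   contributions of the excedances [j], by exchanging the two arcs of a crossing. *)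
Lemma sum_nonexc_under_exc n (s : 'S_n) :
  \sum_(i < n) \sum_(j < n) [&& s j <= j, i < j & j < s i]
  = \sum_(i < n) \sum_(j < n) [&& s j <= j, i < s j & s j < s i].
Proof.
have E1 : \sum_(i < n) \sum_(j < n) [&& j < s j, i < j & j < s i]
   = \sum_(i < n) \sum_(j < n) [&& j < s j, i < s j & s j < s i].
  apply: sum_symmetrize => [i|i j lt_ij]; first by rewrite !ltnn !andbF.
  have := perm_val_neq s (ltn_eqF lt_ij).
  case: (ltngtP (s i) (s j)) => // ? _; lia.
have E2 : \sum_(i < n) \sum_(j < n) ((i < j) && (j < s i))
   = \sum_(i < n) \sum_(j < n) ((i < s j) && (s j < s i)).
  by apply: eq_bigr => i _; rewrite (reindex_inj (@perm_inj _ s)).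
apply/eqP; rewrite -(eqn_add2l (\sum_(i < n) \sum_(j < n) [&& j < s j, i < j & j < s i])) {2}E1.
rewrite -!big_split /=; apply/eqP; transitivity (\sum_(i < n) \sum_(j < n) ((i < j) && (j < s i))).
  by apply: eq_bigr => i _; rewrite -big_split; apply: eq_bigr => j _ /=; lia.
by rewrite E2; apply: eq_bigr => i _; rewrite -big_split; apply: eq_bigr => j _ /=; lia.
Qed.

(** Every term becomes a sum over pairs: $|s(i)-i|$ counts the $j$ between $i$ and $s(i)$, with
    $s(i)$ included and $i$ excluded, and an excedance $i$ is the pair $(i,s(i))$. *)
Lemma crs_inv_exc n (s : 'S_n) :
  crs s + ninv s + nexc s = \sum_(i < n) ((s i - i) + (i - s i)).
Proof.
have -> : nexc s = \sum_(i < n) \sum_(j < n) ((i < s i) && (j == s i :> nat)).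
  apply: eq_bigr => i _; rewrite (bigD1 (s i)) //= eqxx andbT big1 ?addn0 // => j.
  by rewrite -val_eqE /= => /negbTE->; rewrite andbF.
have -> : \sum_(i < n) ((s i - i) + (i - s i)) =
   \sum_(i < n) \sum_(j < n) (((i < j) && (j <= s i)) + ((s i <= j) && (j < i))).
  apply: eq_bigr => i _.
  by rewrite big_split sum_ord_in_Ioc ?sum_ord_in_Ico // ltnW.
rewrite /crs card_pairE /ninv; apply/eqP.
(* Pairwise, the identity is off by the nonexcedances under an excedance. These are added to both
   sides, by position on the left and by value on the right. *)
rewrite -(eqn_add2r (\sum_(i < n) \sum_(j < n) [&& s j <= j, i < j & j < s i])).
rewrite [X in _ == _ + X]sum_nonexc_under_exc -!big_split /=; apply/eqP.
under eq_bigr => i _ do rewrite -!big_split /=.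
under [RHS]eq_bigr => i _ do rewrite -!big_split /=.
apply: sum_symmetrize => [i|i j lt_ij]; rewrite /crossing; first by lia.
have := perm_val_neq s (ltn_eqF lt_ij).
by case: (ltngtP (s i) (s j)) => // ? _; lia.
Qed.

(** * Deleting a point *)

(* Contribution of the point [(i, j)] when excedances are taken with respect to
   the diagonal [j = i + d]. *)
Definition wt (d : int) (i j : nat) : int :=
  (`|j%:Z - i%:Z - d| - (d < j%:Z - i%:Z)%R%:Z)%R.

(* The last term makes the change of [wcrs] under the deletions of the 132 case
   depend on the height of the Dyck path only. *)
Definition wcrs n (d : int) (s : 'S_n) : int :=
  (\sum_(i < n) wt d i (s i) - (ninv s)%:Z - d * (d + 1))%R.

Lemma wcrs0 n (s : 'S_n) : wcrs 0 s = crs s.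
Proof.
suff e : ((crs s + ninv s)%:Z = \sum_(i < n) wt 0 i (s i))%R by rewrite /wcrs -e; lia.
apply: (addIr (Posz (nexc s))); rewrite -PoszD crs_inv_exc /nexc.
rewrite !(big_morph Posz PoszD (erefl _)) -big_split /=.
by apply: eq_bigr => i _; rewrite /wt; lia.
Qed.

(** [lift_perm a b s] inserts the point $(a,b)$ into the diagram of $s$; [bump] moves the rows from
    $a$ on and the columns from $b$ on by one. *)
Lemma sum_lift_perm (V : nmodType) m (F : nat -> nat -> V) (a b : 'I_m.+1) (s : 'S_m) :
  (\sum_(i < m.+1) F i (lift_perm a b s i) =
   F a b + \sum_(k < m) F (bump a k) (bump b (s k)))%R.
Proof.
rewrite (bigD1_ord a) //= lift_perm_id; congr (_ + _)%R.
by apply: eq_bigr => k _; rewrite lift_perm_lift.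
Qed.

Lemma ninv_lift_perm m (a b : 'I_m.+1) (s : 'S_m) :
  ninv (lift_perm a b s) =
  ninv s + (\sum_(k < m) ((k < a) && (b <= s k)) + \sum_(k < m) ((a <= k) && (s k < b))).
Proof.
rewrite /ninv (bigD1_ord a) //= (bigD1_ord a) //= lift_perm_id ltnn add0n.
under [X in _ + X]eq_bigr => i _ do rewrite (bigD1_ord a) //= lift_perm_id lift_perm_lift.
rewrite big_split /= addnC -addnA addnCA; congr (_ + _); last congr (_ + _).
- apply: eq_bigr => i _; apply: eq_bigr => j _; rewrite !lift_perm_lift /= /bump.
  have [/val_inj->|] := eqVneq (i : nat) j; first by rewrite !ltnn.
  by move=> ne; have := perm_val_neq s (negbTE ne); lia.
- by apply: eq_bigr => i _; rewrite /bump; lia.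
- by apply: eq_bigr => i _; rewrite lift_perm_lift /= /bump; lia.
Qed.

Lemma reindex_lift_perm (V : nmodType) m (a b : 'I_m.+1) (P : pred 'S_m.+1) (F : 'S_m.+1 -> V) :
  (\sum_(s : 'S_m.+1 | P s && (s a == b)) F s =
   \sum_(s : 'S_m | P (lift_perm a b s)) F (lift_perm a b s))%R.
Proof.
(* [g s] is $s$ with the point of row $a$ deleted. As $s$ is injective, [unlift] always succeeds and
   the default [k] is never returned. *)
pose g (s : 'S_m.+1) (k : 'I_m) : 'I_m := odflt k (unlift (s a) (s (lift a k))).
have gE (s : 'S_m.+1) k : lift (s a) (g s k) = s (lift a k).
  rewrite /g; case: unliftP => [j -> //|e].
  by have /eqP := perm_inj e; rewrite eq_sym (negbTE (neq_lift _ _)).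
have g_inj (s : 'S_m.+1) : injective (g s).
  by move=> k l e; apply: (@lift_inj _ a); apply: (@perm_inj _ s); rewrite -!gE e.
rewrite (reindex_onto (lift_perm a b) (fun s : 'S_m.+1 => perm (g_inj s))) /=.
  apply: eq_bigl => s; rewrite lift_perm_id eqxx andbT.
  case: (P _) => //=; apply/eqP/permP => k; rewrite permE.
  by apply: (@lift_inj _ b); have := gE (lift_perm a b s) k; rewrite lift_perm_id lift_perm_lift.
move=> s /andP[_ /eqP sa]; apply/permP => i; case: (unliftP a i) => [k|] ->.
  by rewrite lift_perm_lift permE -sa gE.
by rewrite lift_perm_id.
Qed.

Lemma sum_perm_lt m (s : 'S_m) b : b <= m -> \sum_(k < m) (s k < b) = b.
Proof.
move=> le_bm; rewrite -[RHS]subn0 -(sum_ord_in_Ico 0 le_bm).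
by rewrite [RHS](reindex_inj (@perm_inj _ s)).
Qed.

Lemma sum_ord_lt m a : a <= m -> \sum_(k < m) (k < a) = a.
Proof. by move=> le_am; rewrite -[RHS]subn0 -(sum_ord_in_Ico 0 le_am). Qed.

Lemma ninv_lift_perm_0l m (b : 'I_m.+1) (s : 'S_m) : ninv (lift_perm ord0 b s) = ninv s + b.
Proof.
rewrite ninv_lift_perm [X in _ + (X + _)]big1 // add0n; congr (_ + _).
by rewrite -[RHS](sum_perm_lt s) // -ltnS.
Qed.

Lemma ninv_lift_perm_0r m (a : 'I_m.+1) (s : 'S_m) : ninv (lift_perm a ord0 s) = ninv s + a.
Proof.
rewrite ninv_lift_perm [X in _ + (_ + X)]big1 => [|k _]; last by rewrite andbF.
have le_am : a <= m by rewrite -ltnS.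
rewrite addn0 -[in RHS](sum_ord_lt le_am); congr (_ + _).
by apply: eq_bigr => k _; rewrite andbT.
Qed.

Lemma ninv_lift_perm_max m (s : 'S_m) : ninv (lift_perm ord_max ord_max s) = ninv s.
Proof.
rewrite ninv_lift_perm !big1 ?addn0 // => k _ /=; have := ltn_ord k; have := ltn_ord (s k); lia.
Qed.

(** * Permutations avoiding 321 *)

(* Sum of [F] over the weights of the paths of length [l] with steps +1 and -1
   from height [H] to height 0 that stay nonnegative; a down step from height [H]
   has weight [H.-1./2]. *)
Fixpoint dyck (V : nmodType) (l H : nat) (F : int -> V) : V :=
  if l is l'.+1 then
    (dyck l' H.+1 F +
     (if H is H'.+1 then dyck l' H' (fun w => F (w + H'./2%:Z)) else 0))%R
  else if H is 0 then F 0%R else 0%R.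

Definition avoids3 (Q : nat -> nat -> nat -> bool) n (s : 'S_n) : bool :=
  [forall i : 'I_n, forall j : 'I_n, forall k : 'I_n,
     (i < j) && (j < k) ==> ~~ Q (s i) (s j) (s k)].

Lemma avoids3P (Q : nat -> nat -> nat -> bool) n (s : 'S_n) :
  reflect (forall i j k : 'I_n, i < j -> j < k -> ~~ Q (s i) (s j) (s k)) (avoids3 Q s).
Proof.
apply: (iffP idP) => [+ i j k lt_ij lt_jk|H].
  by move/forallP/(_ i)/forallP/(_ j)/forallP/(_ k); rewrite lt_ij lt_jk.
by apply/forallP=> i; apply/forallP=> j; apply/forallP=> k; apply/implyP=> /andP[/H]; apply.
Qed.

Definition is132 (a b c : nat) := (a < c) && (c < b).
Definition is321 (a b c : nat) := (c < b) && (b < a).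

Lemma perm_preim n (s : 'S_n) (v : 'I_n) : exists k, s k = v.
Proof. by exists (s^-1 v)%g; rewrite permKV. Qed.

(* What is left of a 321-avoiding permutation when [p] rows and [r] columns have
   been read whose points are not yet deleted. *)
Definition B321 n p r (s : 'S_n) : bool :=
  avoids3 is321 s && [forall i : 'I_n, (i < p) ==> (r <= s i)].

Lemma B321P n p r (s : 'S_n) :
  reflect ((forall i j k : 'I_n, i < j -> j < k -> ~~ is321 (s i) (s j) (s k)) /\
           (forall i : 'I_n, i < p -> r <= s i)) (B321 p r s).
Proof.
apply: (iffP andP) => -[H1 H2]; split; try exact/avoids3P.
  by move=> i; move/forallP/(_ i)/implyP: H2.
by apply/forallP=> i; apply/implyP; apply: H2.
Qed.

Lemma B321_0S n (s : 'S_n) r : B321 0 r s = avoids3 is321 s.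
Proof. by rewrite /B321; apply/andb_idr => _; apply/forallP. Qed.

Lemma B321_col_close m h (b : 'I_m.+1) (s : 'S_m) : b = h.+1 :> nat ->
  B321 h.+1 h.+1 (lift_perm ord0 b s) = B321 h h.+1 s.
Proof.
move=> bE; apply/B321P/B321P => -[H1 H2]; split.
- move=> i j k lt_ij lt_jk; have := H1 (lift ord0 i) (lift ord0 j) (lift ord0 k).
  by rewrite !lift_perm_lift /is321 /= /bump; lia.
- by move=> i lt_ih; have := H2 (lift ord0 i); rewrite lift_perm_lift /= /bump; lia.
- move=> i j k; case: (unliftP ord0 j) => [j'|] -> //; case: (unliftP ord0 k) => [k'|] -> //.
  case: (unliftP ord0 i) => [i'|] ->; rewrite ?lift_perm_lift ?lift_perm_id.
    by move=> lt_ij lt_jk; have := H1 i' j' k'; rewrite /is321 /= /bump in lt_ij lt_jk *; lia.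
  move=> _ lt_jk; apply/negP => bad; rewrite /is321 /= /bump in lt_jk bad.
  have m0 : 0 < m by have := ltn_ord j'; lia.
  (* Were the new point the first of a 321, row 0 of $s$ could replace it when $h>0$, being open and
     hence of larger value than the other two; when $h=0$ only one value is smaller than $b$. *)
  pose z := Ordinal m0.
  have [h0|h_gt0] := posnP h; first by lia.
  have zh : z < h by [].
  have := H2 z zh; have := H2 j'; have := H1 z j' k'; rewrite /is321 /=.
  by have [/= j0|] := posnP j'; lia.
- move=> i; case: (unliftP ord0 i) => [i'|] ->; rewrite ?lift_perm_lift ?lift_perm_id ?bE //.
  by have := H2 i'; rewrite /= /bump; lia.
Qed.

(** A column can only close with the first open row: had a later open row $i$ the value $h+1$, then
    row 0, row $i$ and the row of the value 0 would form a 321. *)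
Lemma B321_col_open m h (b : 'I_m.+1) (s : 'S_m.+1) : b = h.+1 :> nat ->
  B321 h.+1 h.+1 s && (s ord0 != b) = B321 h.+1 h.+2 s.
Proof.
move=> bE; apply/andP/B321P => [[/B321P[H1 H2] sb]|[H1 H2]]; last first.
  split; last by have := H2 ord0; rewrite -val_eqE /=; lia.
  by apply/B321P; split=> // i /H2; lia.
split=> // i lt_ih; have := H2 i lt_ih; rewrite leq_eqVlt => /orP[/eqP si|//].
have [k sk] := perm_preim s ord0.
have := H2 ord0 isT; have := H2 k; have := H1 ord0 i k; rewrite sk /is321 /=.
have i0 : (i : nat) != 0.
  apply: contraNneq sb => i0; rewrite -val_eqE /= bE si; apply/eqP.
  by congr (nat_of_ord (s _)); apply: val_inj; rewrite /= i0.
by rewrite -val_eqE /= in sb; lia.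
Qed.

Lemma B321_row_close m h (a : 'I_m.+1) (s : 'S_m) : a = h :> nat ->
  B321 h h.+1 (lift_perm a ord0 s) = B321 h h s.
Proof.
move=> aE; apply/B321P/B321P => -[H1 H2]; split.
- move=> i j k lt_ij lt_jk; have := H1 (lift a i) (lift a j) (lift a k).
  by rewrite !lift_perm_lift /is321 /= /bump; lia.
- by move=> i lt_ih; have := H2 (lift a i); rewrite lift_perm_lift /= /bump; lia.
- move=> i j k.
  case: (unliftP a i) => [i'|] ->; rewrite ?lift_perm_lift ?lift_perm_id /is321 /=; last by lia.
  case: (unliftP a j) => [j'|] ->; rewrite ?lift_perm_lift ?lift_perm_id /=; last by lia.
  case: (unliftP a k) => [k'|] ->; rewrite ?lift_perm_lift ?lift_perm_id /= /bump.
    by move=> ? ?; have := H1 i' j' k'; rewrite /is321; lia.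
  move=> lt_ij lt_ja; apply/negP => bad.
  have m0 : 0 < m by have := ltn_ord j'; lia.
  (* Were the new point the last of a 321, the row of the value 0 of $s$ could replace it: [i'] and
     [j'] are open, so that row comes after them. *)
  have [l sl] := perm_preim s (Ordinal m0).
  by have := H2 i'; have := H2 j'; have := H2 l; have := H1 i' j' l; rewrite sl /is321 /=; lia.
- move=> i; case: (unliftP a i) => [i'|] ->; rewrite ?lift_perm_lift ?lift_perm_id.
    by have := H2 i'; rewrite /= /bump; lia.
  by rewrite aE ltnn.
Qed.

Lemma B321_row_open m h (a : 'I_m.+1) (s : 'S_m.+1) : a = h :> nat ->
  B321 h h.+1 s && (s a != ord0) = B321 h.+1 h.+1 s.
Proof.
move=> aE; apply/andP/B321P => [[/B321P[H1 H2] sa]|[H1 H2]]; last first.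
  split; last by have := H2 a; rewrite -val_eqE /=; lia.
  by apply/B321P; split=> // i ?; apply: H2; lia.
split=> // i; rewrite ltnS leq_eqVlt => /orP[/eqP ia|/H2//].
have {ia}-> : i = a by apply: val_inj; rewrite /= ia.
rewrite -val_eqE /= in sa.
have [k sk] := perm_preim s ord0.
have ka : (k : nat) != a by apply: contraNneq sa => /val_inj<-; rewrite sk.
by have := H2 ord0; have := H2 k; have := H1 ord0 a k; rewrite sk /is321 /=; lia.
Qed.

(** The $h+1$ points in columns before $b$ are not excedances, so the insertion moves each one step
    away from the diagonal. This cancels their inversions with the new point, whose own weight is
    $h$. *)
Lemma wcrs_col_close m h (b : 'I_m.+1) (s : 'S_m) : b = h.+1 :> nat -> B321 h h.+1 s ->
  wcrs 0 (lift_perm ord0 b s) = (wcrs 0 s + h%:Z)%R.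
Proof.
move=> bE /B321P[_ H2]; have le_bm : b <= m by rewrite -ltnS.
rewrite /wcrs ninv_lift_perm_0l sum_lift_perm.
have -> : (\sum_(k < m) wt 0 (bump (@ord0 m) k) (bump b (s k)) =
   \sum_(k < m) wt 0 k (s k) + b%:Z)%R.
  rewrite -[X in (_ = _ + Posz X)%R](sum_perm_lt s le_bm) (big_morph Posz PoszD (erefl _)) -big_split.
  by apply: eq_bigr => k _; have := H2 k; rewrite /wt /bump /=; lia.
by rewrite /wt /= bE; lia.
Qed.

(** Likewise, the $h$ points in rows before $a$ are excedances; their gain cancels the $h$ new
    inversions. *)
Lemma wcrs_row_close m h (a : 'I_m.+1) (s : 'S_m) : a = h :> nat -> B321 h h s ->
  wcrs 0 (lift_perm a ord0 s) = (wcrs 0 s + h%:Z)%R.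
Proof.
move=> aE /B321P[_ H2]; have le_am : a <= m by rewrite -ltnS.
rewrite /wcrs ninv_lift_perm_0r sum_lift_perm.
have -> : (\sum_(k < m) wt 0 (bump a k) (bump (@ord0 m) (s k)) =
   \sum_(k < m) wt 0 k (s k) + a%:Z)%R.
  rewrite -[X in (_ = _ + Posz X)%R](sum_ord_lt le_am) (big_morph Posz PoszD (erefl _)) -big_split.
  by apply: eq_bigr => k _; have := H2 k; rewrite /wt /bump /=; lia.
by rewrite /wt /= aE; lia.
Qed.

(** The height counts the open rows and columns, and [l] the unread ones. A column is read at even
    heights, a row at odd ones; opening is an up step, closing a down step. *)
Lemma sum_B321 (V : nmodType) l n h (F : int -> V) :
  (l + h.*2 = n.*2 ->
   (\sum_(s : 'S_n | B321 h h s) F (wcrs 0 s))%R = dyck l h.*2 F) /\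
  (l + h.*2.+1 = n.*2 ->
   (\sum_(s : 'S_n | B321 h h.+1 s) F (wcrs 0 s))%R = dyck l h.*2.+1 F).
Proof.
elim: l n h F => [|l IHl] n h F; split=> e.
- have nE : n = h by lia.
  case: h n nE {e} => [|h] n ->.
    rewrite (big_pred1 1%g) => [|s]; last first.
      rewrite B321_0S; apply/idP/eqP => _; first by apply/permP => -[].
      by apply/avoids3P => -[].
    by rewrite /wcrs /ninv !big_ord0.
  by rewrite big1 // => s /B321P[_ /(_ ord0 isT)]; have := ltn_ord (s ord0); lia.
- lia.
- case: n e => [|m] e; first lia.
  case: h e => [|h] e /=.
    (* At height 0 no row is open, so the first column can only open. *)
    rewrite addr0 -(IHl m.+1 0 F).2; last by lia.
    by apply: eq_bigl => s; rewrite !B321_0S.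
  have lt_b : h.+1 < m.+1 by lia.
  pose b := Ordinal lt_b.
  rewrite (bigID (fun s : 'S_m.+1 => s ord0 == b)) /= addrC; congr (_ + _)%R.
    rewrite -(IHl m.+1 h.+1 F).2; last by lia.
    by apply: eq_bigl => s; rewrite (B321_col_open (h := h)).
  rewrite reindex_lift_perm -(IHl m h (fun w => F (w + _)%R)).2; last by lia.
  rewrite uphalf_double.
  apply: eq_big => s; first by rewrite (B321_col_close (h := h)).
  by rewrite (B321_col_close (h := h)) // => Bs; rewrite (wcrs_col_close (h := h)).
- case: n e => [|m] e; first lia.
  have lt_a : h < m.+1 by lia.
  pose a := Ordinal lt_a.
  rewrite (bigID (fun s : 'S_m.+1 => s a == ord0)) /= addrC; congr (_ + _)%R.
    rewrite -[h.*2.+2]/(h.+1.*2) -(IHl m.+1 h.+1 F).1; last by lia.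
    by apply: eq_bigl => s; rewrite (B321_row_open (h := h)).
  rewrite reindex_lift_perm -(IHl m h (fun w => F (w + _)%R)).1; last by lia.
  rewrite doubleK.
  apply: eq_big => s; first by rewrite (B321_row_close (h := h)).
  by rewrite (B321_row_close (h := h)) // => Bs; rewrite (wcrs_row_close (h := h)).
Qed.

(** * Permutations avoiding 132 *)

Lemma dyck_eq0 (V : nmodType) l H (F : int -> V) : l < H -> dyck l H F = 0%R.
Proof.
elim: l H F => [|l IHl] [|H] F //= lt_lH; rewrite IHl ?add0r ?IHl //; lia.
Qed.

(* What is left of a 132-avoiding permutation when the last [p] rows and the last
   [r] columns have been read and their points are not yet deleted. *)
Definition A132 n p r (s : 'S_n) : bool :=
  [&& (p <= n) && (r <= n), avoids3 is132 s,
      [forall i : 'I_n, forall j : 'I_n, (n <= i + p) && (i < j) ==> (s i < s j)],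
      [forall i : 'I_n, forall j : 'I_n, (n <= s i + r) && (s i < s j) ==> (i < j)]
    & [forall i : 'I_n, (n <= i + p) ==> (s i + r < n)]].

Lemma A132P n p r (s : 'S_n) :
  reflect [/\ p <= n /\ r <= n,
    forall i j k : 'I_n, i < j -> j < k -> ~~ is132 (s i) (s j) (s k),
    forall i j : 'I_n, n <= i + p -> i < j -> s i < s j,
    forall i j : 'I_n, n <= s i + r -> s i < s j -> i < j
    & forall i : 'I_n, n <= i + p -> s i + r < n] (A132 p r s).
Proof.
apply: (iffP and5P) => -[H1 H2 H3 H4 H5]; split; try exact/avoids3P; try exact/andP.
- by move=> i j ? ?; move/forallP/(_ i)/forallP/(_ j)/implyP: H3; apply; apply/andP.
- by move=> i j ? ?; move/forallP/(_ i)/forallP/(_ j)/implyP: H4; apply; apply/andP.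
- by move=> i; move/forallP/(_ i)/implyP: H5.
- by apply/forallP=> i; apply/forallP=> j; apply/implyP=> /andP[]; apply: H3.
- by apply/forallP=> i; apply/forallP=> j; apply/implyP=> /andP[]; apply: H4.
- by apply/forallP=> i; apply/implyP; apply: H5.
Qed.

(** The pattern 132 is its own inverse. Inversion exchanges the two ends, so the facts about the
    right end follow from those about the left end. *)
Lemma A132V n p r (s : 'S_n) : A132 p r s^-1%g = A132 r p s.
Proof.
suff imp q t (u : 'S_n) : A132 q t u -> A132 t q u^-1%g.
  by apply/idP/idP => /imp //; rewrite invgK.
case/A132P => -[H1 H1'] H2 H3 H4 H5; apply/A132P; split=> //.
- move=> i j k lt_ij lt_jk.
  by have := H2 (u^-1 i)%g (u^-1 k)%g (u^-1 j)%g; rewrite !permKV /is132; lia.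
- by move=> i j ? ?; apply: H4; rewrite !permKV.
- by move=> i j ? ?; have := H3 (u^-1 i)%g (u^-1 j)%g; rewrite !permKV; apply.
- move=> i le_n; rewrite ltnNge; apply/negP => /H5; rewrite permKV; lia.
Qed.

(** Upwards from the last row, whose value is below $n-r$: the values increase along the last $p$
    rows. *)
Lemma A132_tail n p r (s : 'S_n) (i : 'I_n) : A132 p r s -> n <= i + p -> s i + r <= i.
Proof.
case/A132P => _ _ H3 _ H5.
have [t] : exists t, i + t.+1 = n by exists (n - i.+1); have := ltn_ord i; lia.
elim: t i => [|t IHt] i e le_n; first by have := H5 i le_n; lia.
have lt_j : i.+1 < n by lia.
by have := IHt (Ordinal lt_j); have := H3 i (Ordinal lt_j) le_n; rewrite /=; lia.
Qed.

Lemma A132_top n p r (s : 'S_n) (i : 'I_n) : A132 p r s -> n <= s i + r -> i + p <= s i.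
Proof. by rewrite -A132V => As le_n; have := A132_tail As le_n; rewrite permK. Qed.

(** A 132 using the value 0 starts with it and needs a larger value before a smaller one after row
    $a$, where [A132] makes the values increase. *)
Lemma A132_left_close m p r (a : 'I_m.+1) (s : 'S_m) : a + p = m ->
  A132 p.+1 r (lift_perm a ord0 s) = A132 p r s.
Proof.
move=> aE; apply/A132P/A132P => -[[H1 H1'] H2 H3 H4 H5]; split.
- by have := H5 a; rewrite lift_perm_id /=; lia.
- move=> i j k lt_ij lt_jk; have := H2 (lift a i) (lift a j) (lift a k).
  by rewrite !lift_perm_lift /is132 /= /bump; lia.
- by move=> i j ? ?; have := H3 (lift a i) (lift a j); rewrite !lift_perm_lift /= /bump; lia.
- by move=> i j ? ?; have := H4 (lift a i) (lift a j); rewrite !lift_perm_lift /= /bump; lia.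
- by move=> i ?; have := H5 (lift a i); rewrite lift_perm_lift /= /bump; lia.
- lia.
- move=> i j k.
  case: (unliftP a j) => [j'|] ->; rewrite ?lift_perm_lift ?lift_perm_id /is132 /=; last lia.
  case: (unliftP a k) => [k'|] ->; rewrite ?lift_perm_lift ?lift_perm_id /=; last lia.
  case: (unliftP a i) => [i'|] ->; rewrite ?lift_perm_lift ?lift_perm_id /= /bump.
    by move=> ? ?; have := H2 i' j' k'; rewrite /is132; lia.
  by move=> ? ?; have := H3 j' k'; lia.
- move=> i j.
  case: (unliftP a j) => [j'|] ->; rewrite ?lift_perm_lift ?lift_perm_id /=; last lia.
  case: (unliftP a i) => [i'|] ->; rewrite ?lift_perm_lift ?lift_perm_id /= /bump; last lia.
  by move=> ? ?; have := H3 i' j'; lia.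
- move=> i j.
  case: (unliftP a j) => [j'|] ->; rewrite ?lift_perm_lift ?lift_perm_id /=; last lia.
  case: (unliftP a i) => [i'|] ->; rewrite ?lift_perm_lift ?lift_perm_id /= /bump; last lia.
  by move=> ? ?; have := H4 i' j'; lia.
- move=> i; case: (unliftP a i) => [i'|] ->; rewrite ?lift_perm_lift ?lift_perm_id /= /bump; last lia.
  by move=> ?; have := H5 i'; lia.
Qed.

(** If row $a$ misses column 0, the value 0 lies in an earlier row, since values increase from row
    $a$ on. Avoiding 132 then makes the value just before row $a$ smaller than that of row $a$, so
    this row joins the open ones. *)
Lemma A132_left_open m p r (a : 'I_m.+1) (s : 'S_m.+1) : a + p = m ->
  A132 p.+1 r s && (s a != ord0) = A132 p.+2 r s.
Proof.
move=> aE; apply/andP/A132P => [[/A132P[[H1 H1'] H2 H3 H4 H5] sa]|[[H1 H1'] H2 H3 H4 H5]]; last first.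
  split.
    by apply/A132P; split=> // [|i j ? ?|i ?]; [lia|apply: H3; lia|apply: H5; lia].
  have lt_a : a.-1 < m.+1 by lia.
  by have := H3 (Ordinal lt_a) a; rewrite -val_eqE /=; lia.
rewrite -val_eqE /= in sa.
have [k sk] := perm_preim s ord0.
have ka : (k : nat) != a by apply: contraNneq sa => /val_inj<-; rewrite sk.
have lt_ka : k < a by have := H3 a k; rewrite sk /=; lia.
have lt_pred (i : 'I_m.+1) : i.+1 = a -> s i < s a.
  move=> ia; have := H2 k i a; rewrite sk /is132 /=.
  have [/val_inj ki|ki] := eqVneq (k : nat) i; first by rewrite -ki sk /=; lia.
  have : s i != s a :> nat by apply: perm_val_neq; lia.
  lia.
split=> //; first by lia.
  move=> i j le_n lt_ij; have [?|ia] := boolP (m.+1 <= i + p.+1); first exact: H3.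
  have := lt_pred i; have [/val_inj->|] := eqVneq (j : nat) a; first by lia.
  by have := H3 a j; lia.
move=> i le_n; have [?|ia] := boolP (m.+1 <= i + p.+1); first exact: H5.
by have := lt_pred i; have := H5 a; lia.
Qed.

(** With no open row, the step at the left end concerns the last row, and closing it deletes the
    corner point. *)
Lemma A132_left_cross m r (s : 'S_m) :
  A132 0 r.+1 (lift_perm ord_max ord_max s) = A132 0 r s.
Proof.
apply/A132P/A132P => -[[H1 H1'] H2 H3 H4 H5]; split; rewrite ?addn0.
- lia.
- move=> i j k lt_ij lt_jk; have := H2 (lift ord_max i) (lift ord_max j) (lift ord_max k).
  by rewrite !lift_perm_lift /is132 /= /bump; lia.
- by move=> i j; have := ltn_ord i; lia.
- by move=> i j ? ?; have := H4 (lift ord_max i) (lift ord_max j); rewrite !lift_perm_lift /= /bump; lia.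
- by move=> i; have := ltn_ord i; lia.
- lia.
- move=> i j k.
  case: (unliftP ord_max i) => [i'|] ->; rewrite ?lift_perm_lift ?lift_perm_id /= /bump; last first.
    by have := ltn_ord j; lia.
  case: (unliftP ord_max j) => [j'|] ->; rewrite ?lift_perm_lift ?lift_perm_id /= /bump; last first.
    by have := ltn_ord k; lia.
  case: (unliftP ord_max k) => [k'|] ->; rewrite ?lift_perm_lift ?lift_perm_id /= /bump /is132; last first.
    by have := ltn_ord (s j'); lia.
  by move=> ? ?; have := H2 i' j' k'; rewrite /is132; lia.
- by move=> i j; have := ltn_ord i; lia.
- move=> i j.
  case: (unliftP ord_max i) => [i'|] ->; rewrite ?lift_perm_lift ?lift_perm_id /= /bump; last first.
    by move=> _; rewrite ltnNge -ltnS ltn_ord.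
  case: (unliftP ord_max j) => [j'|] ->; rewrite ?lift_perm_lift ?lift_perm_id /= /bump; last first.
    by have := @ltn_ord m i'; lia.
  by move=> ? ?; have := H4 i' j'; have := ltn_ord (s i'); have := ltn_ord (s j'); lia.
- by move=> i; have := ltn_ord i; lia.
Qed.

(** If the last row meets an open column, it is the last one: larger values would have to stand in
    later rows. *)
Lemma A132_left_cross_open m r (s : 'S_m.+1) :
  A132 0 r.+1 s && (s ord_max != ord_max) = A132 1 r.+1 s.
Proof.
apply/andP/A132P => [[/A132P[[H1 H1'] H2 H3 H4 H5] sa]|[[H1 H1'] H2 H3 H4 H5]]; last first.
  split; last by have := H5 ord_max; rewrite -val_eqE /=; lia.
  by apply/A132P; split=> // [i j|i]; have := ltn_ord i; lia.
split=> // [i j|i]; first by have := ltn_ord j; lia.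
rewrite addn1 ltnS => le_mi; have -> : i = ord_max.
  by apply: val_inj; have := ltn_ord i; rewrite /=; lia.
rewrite -val_eqE /= in sa.
have [k sk] := perm_preim s ord_max.
by have := H4 ord_max k; rewrite sk /=; have := ltn_ord k; have := ltn_ord (s ord_max); lia.
Qed.

Lemma A132_00 m (s : 'S_m.+1) : A132 0 0 s = A132 1 0 s.
Proof.
apply/A132P/A132P => -[[H1 H1'] H2 H3 H4 H5]; split=> //.
- by move=> i j; have := ltn_ord j; lia.
- by move=> i; have := ltn_ord (s i); lia.
- by move=> i j; have := ltn_ord i; lia.
- by move=> i; have := ltn_ord i; lia.
Qed.

Lemma A132_avoids n (s : 'S_n) : A132 0 0 s = avoids3 is132 s.
Proof.
apply/A132P/avoids3P => [[]//|H2]; split=> // [i j|i j|i].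
- by have := ltn_ord i; lia.
- by have := ltn_ord (s i); lia.
- by have := ltn_ord i; lia.
Qed.

Lemma A132_right_close m p r (b : 'I_m.+1) (s : 'S_m) : b + r = m ->
  A132 p r.+1 (lift_perm ord0 b s) = A132 p r s.
Proof. by move=> bE; rewrite -A132V lift_permV A132_left_close // A132V. Qed.

Lemma A132_right_open m p r (b : 'I_m.+1) (s : 'S_m.+1) : b + r = m ->
  A132 p r.+1 s && (s ord0 != b) = A132 p r.+2 s.
Proof.
move=> bE; rewrite -[RHS]A132V -(A132_left_open _ _ bE) A132V.
by rewrite -(inj_eq (@perm_inj _ s) (s^-1 b)%g) permKV [b == _]eq_sym.
Qed.

Lemma A132_right_cross m p (s : 'S_m) :
  A132 p.+1 0 (lift_perm ord_max ord_max s) = A132 p 0 s.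
Proof. by rewrite -A132V lift_permV A132_left_cross A132V. Qed.

Lemma A132_right_cross_open m p (s : 'S_m.+1) :
  A132 p.+1 0 s && (s ord_max != ord_max) = A132 p.+1 1 s.
Proof.
rewrite -[RHS]A132V -A132_left_cross_open A132V.
by rewrite -(inj_eq (@perm_inj _ s) (s^-1 ord_max)%g) permKV [ord_max == _]eq_sym.
Qed.

(** Points in rows before $a$ keep their weight, the diagonal moving with them; by [A132_tail] the
    $p$ other points gain 1 each. The new point weighs $a+d$ and makes $a$ inversions, and the last
    term of [wcrs] adds $-2d$: in total $p-d=h-1$. *)
Lemma wcrs_left_close m p r h (d : int) (a : 'I_m.+1) (s : 'S_m) :
  (a + p = m)%N -> A132 p r s -> (p.+1%:Z = h%:Z + d)%R -> (r%:Z = h%:Z - d)%R ->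
  wcrs d (lift_perm a ord0 s) = (wcrs (d - 1) s + h.-1%:Z)%R.
Proof.
move=> aE As pE rE; have [[le_pm le_rm] _ _ _ _] := A132P _ _ _ As.
rewrite /wcrs ninv_lift_perm_0r sum_lift_perm.
have -> : (\sum_(k < m) wt d (bump a k) (bump (@ord0 m) (s k)) =
   \sum_(k < m) wt (d - 1) k (s k) + p%:Z)%R.
  have -> : p = \sum_(k < m) ((a <= k) && (k < m)) by rewrite sum_ord_in_Ico //; lia.
  rewrite (big_morph Posz PoszD (erefl _)) -big_split /=.
  apply: eq_bigr => k _; have := ltn_ord k; have := A132_tail (i := k) As.
  by rewrite /wt /bump /=; lia.
by rewrite /wt /=; lia.
Qed.

(** Here the $r$ points in columns from $b$ on gain 1 each, the new point weighs $b-d-1$ and makes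
    $b$ inversions, and the last term adds $2d+2$: in total $r+d+1=h$. *)
Lemma wcrs_right_close m p r h (d : int) (b : 'I_m.+1) (s : 'S_m) :
  (b + r = m)%N -> A132 p r s -> (p%:Z = h.+1%:Z + d)%R -> (r.+1%:Z = h%:Z - d)%R ->
  wcrs d (lift_perm ord0 b s) = (wcrs (d + 1) s + h%:Z)%R.
Proof.
move=> bE As pE rE; have [[le_pm le_rm] _ _ _ _] := A132P _ _ _ As.
rewrite /wcrs ninv_lift_perm_0l sum_lift_perm.
have -> : (\sum_(k < m) wt d (bump (@ord0 m) k) (bump b (s k)) =
   \sum_(k < m) wt (d + 1) k (s k) + r%:Z)%R.
  have -> : r = \sum_(k < m) ((b <= s k) && (s k < m)).
    transitivity (\sum_(k < m) ((b <= k) && (k < m))); first by rewrite sum_ord_in_Ico //; lia.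
    by rewrite (reindex_inj (@perm_inj _ s)).
  rewrite (big_morph Posz PoszD (erefl _)) -big_split /=.
  apply: eq_bigr => k _; have := ltn_ord (s k); have := A132_top (i := k) As.
  by rewrite /wt /bump /=; lia.
by rewrite /wt /=; lia.
Qed.

Lemma wcrs_lift_max m (d : int) (s : 'S_m) :
  wcrs d (lift_perm ord_max ord_max s) = (wcrs d s + (`|d| - (d < 0)%R%:Z))%R.
Proof.
rewrite /wcrs ninv_lift_perm_max sum_lift_perm.
have -> : (\sum_(k < m) wt d (bump (@ord_max m) k) (bump (@ord_max m) (s k)) =
   \sum_(k < m) wt d k (s k))%R.
  apply: eq_bigr => k _; congr wt.
    by have := ltn_ord k; rewrite /bump /=; lia.
  by have := ltn_ord (s k); rewrite /bump /=; lia.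
by rewrite /wt /=; lia.
Qed.

(* At even heights [2 h] one has [p = h + d], [r = h - d], and a step is read at
   the left end: the row above the last [p] rows, or the first column.  At odd
   heights [2 h + 1] one has [p = h + 1 + d], [r = h - d], and it is read at the
   right end. *)
Lemma sum_A132 (V : nmodType) l n p r h (d : int) (F : int -> V) :
  (l + p + r = n.*2)%N -> (r%:Z = h%:Z - d)%R ->
  ((p%:Z = h%:Z + d)%R ->
   (\sum_(s : 'S_n | A132 p r s) F (wcrs d s))%R = dyck l h.*2 F) /\
  ((p%:Z = h.+1%:Z + d)%R ->
   (\sum_(s : 'S_n | A132 p r s) F (wcrs d s))%R = dyck l h.*2.+1 F).
Proof.
elim: l n p r h d F => [|l IHl] n p r h d F lE rE; split=> pE.
- case: n lE => [|n] lE.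
    have [-> -> -> ->] : [/\ p = 0, r = 0, h = 0 & d = 0%R] by split; lia.
    rewrite (big_pred1 1%g) => [|s]; last first.
      rewrite A132_avoids; apply/idP/eqP => _; first by apply/permP => -[].
      by apply/avoids3P => -[].
    by rewrite /wcrs /ninv !big_ord0.
  rewrite dyck_eq0; last by lia.
  apply: big1 => s /A132P[[? ?] _ _ _ /(_ ord0)] /=; lia.
- lia.
- case: n lE => [|m] lE; first lia.
  case: p lE pE => [|p] lE pE.
    case: h rE pE => [|h] rE pE /=.
      (* At height 0 no column is open, so the last row can only open. *)
      have -> : r = 0 by lia.
      rewrite addr0 -(IHl m.+1 1 0 0 d F _ _).2; [|lia|lia|lia].
      by apply: eq_bigl => s; rewrite A132_00.
    case: r rE lE => [|r] rE lE; first lia.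
    rewrite (bigID (fun s : 'S_m.+1 => s ord_max == ord_max)) /= addrC; congr (_ + _)%R.
      rewrite -(IHl m.+1 1 r.+1 h.+1 d F _ _).2; [|lia|lia|lia].
      by apply: eq_bigl => s; rewrite A132_left_cross_open.
    rewrite reindex_lift_perm uphalf_double.
    rewrite -(IHl m 0 r h d (fun w => F (w + _)%R) _ _).2; [|lia|lia|lia].
    apply: eq_big => s; first by rewrite A132_left_cross.
    (* Here $d=-(h+1)$, so the corner point weighs $h$. *)
    by move=> _; rewrite wcrs_lift_max; congr (F (_ + _)%R); lia.
  have [lt_mp|le_pm] := ltnP m p.
    (* There would be more open rows than rows, and the height exceeds the remaining length: both
       sides vanish. *)
    rewrite dyck_eq0; last by lia.
    by apply: big1 => s /A132P[[? ?] _ _ _ _]; lia.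
  have lt_a : m - p < m.+1 by lia.
  pose a := Ordinal lt_a.
  have aE : (a + p = m)%N by rewrite /=; lia.
  case: h rE pE => [|h] rE pE /=; first lia.
  rewrite (bigID (fun s : 'S_m.+1 => s a == ord0)) /= addrC; congr (_ + _)%R.
    rewrite -(IHl m.+1 p.+2 r h.+1 d F _ _).2; [|lia|lia|lia].
    by apply: eq_bigl => s; rewrite A132_left_open.
  rewrite reindex_lift_perm uphalf_double.
  rewrite -(IHl m p r h (d - 1)%R (fun w => F (w + _)%R) _ _).2; [|lia|lia|lia].
  apply: eq_big => s; first by rewrite A132_left_close.
  by rewrite A132_left_close // => As; rewrite (wcrs_left_close (h := h.+1) aE As).
- case: n lE => [|m] lE; first lia.
  case: r lE rE => [|r] lE rE.
    case: p lE pE => [|p] lE pE; first lia.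
    rewrite (bigID (fun s : 'S_m.+1 => s ord_max == ord_max)) /= addrC; congr (_ + _)%R.
      rewrite -[h.*2.+2]/(h.+1.*2) -(IHl m.+1 p.+1 1 h.+1 d F _ _).1; [|lia|lia|lia].
      by apply: eq_bigl => s; rewrite A132_right_cross_open.
    rewrite reindex_lift_perm doubleK.
    rewrite -(IHl m p 0 h d (fun w => F (w + _)%R) _ _).1; [|lia|lia|lia].
    apply: eq_big => s; first by rewrite A132_right_cross.
    (* Here $d=h$, so the corner point again weighs $h$. *)
    by move=> _; rewrite wcrs_lift_max; congr (F (_ + _)%R); lia.
  have [lt_mr|le_rm] := ltnP m r.
    rewrite dyck_eq0; last by lia.
    by apply: big1 => s /A132P[[? ?] _ _ _ _]; lia.
  have lt_b : m - r < m.+1 by lia.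
  pose b := Ordinal lt_b.
  have bE : (b + r = m)%N by rewrite /=; lia.
  rewrite (bigID (fun s : 'S_m.+1 => s ord0 == b)) /= addrC; congr (_ + _)%R.
    rewrite -[h.*2.+2]/(h.+1.*2) -(IHl m.+1 p r.+2 h.+1 d F _ _).1; [|lia|lia|lia].
    by apply: eq_bigl => s; rewrite A132_right_open.
  rewrite reindex_lift_perm doubleK.
  rewrite -(IHl m p r h (d + 1)%R (fun w => F (w + _)%R) _ _).1; [|lia|lia|lia].
  apply: eq_big => s; first by rewrite A132_right_close.
  by rewrite A132_right_close // => As; rewrite (wcrs_right_close (h := h) bE As).
Qed.

Lemma crs_132_321 (V : nmodType) n (F : int -> V) :
  (\sum_(s : 'S_n | avoids3 is132 s) F (crs s) =
   \sum_(s : 'S_n | avoids3 is321 s) F (crs s))%R.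
Proof.
transitivity (dyck n.*2 0 F).
  rewrite -(sum_A132 (n := n) (p := 0) (r := 0) (h := 0) (d := 0) F _ _).1 //; last by lia.
  by apply: eq_big => s; rewrite ?A132_avoids // wcrs0.
rewrite -(sum_B321 n.*2 n 0 F).1 //; last by lia.
by apply: eq_big => s; rewrite ?B321_0S // wcrs0.
Qed.

(** * Patterns and symmetries *)

Lemma map_enum_ord3 (T : Type) (g : 'I_3 -> T) :
  [seq g a | a <- enum 'I_3] = [:: g (inord 0); g (inord 1); g (inord 2)].
Proof.
rewrite !enum_ordSl /= (_ : enum 'I_0 = [::]); last by apply: size0nil; rewrite size_enum_ord.
by congr [:: g _; g _; g _]; apply: val_inj; rewrite /= inordK.
Qed.

Lemma red3_succ a b c : red [:: a.+1; b.+1; c.+1] = red [:: a; b; c].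
Proof. by rewrite /red /= !ltnS. Qed.

Lemma avoids_avoids3 n (s : 'S_n) (t : 'S_3) (Q : nat -> nat -> nat -> bool) :
  (forall a b c, Q a b c = (red [:: a; b; c] == word t)) -> avoids s t = avoids3 Q s.
Proof.
move=> QE; rewrite /avoids; apply/negP/avoids3P => [H i j k lt_ij lt_jk|H].
  apply/negP; rewrite QE => Qs; apply: H; apply/existsP.
  exists [ffun a : 'I_3 => nth i [:: i; j; k] a]; apply/andP; split.
    apply/forallP => a; apply/forallP => b; apply/implyP; rewrite !ffunE.
    by case: a b => [[|[|[|a]]] la] [[|[|[|b]]] lb] //= _; apply: ltn_trans lt_jk.
  by rewrite map_enum_ord3 !ffunE !inordK //= red3_succ.
case/existsP => f /andP[/forallP f_mono]; rewrite map_enum_ord3 red3_succ -QE.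
apply/negP; apply: H.
  by have /forallP/(_ (inord 1))/implyP := f_mono (inord 0); apply; rewrite !inordK.
by have /forallP/(_ (inord 2))/implyP := f_mono (inord 1); apply; rewrite !inordK.
Qed.

Definition is123 (a b c : nat) := (a < b) && (b < c).
Definition is213 (a b c : nat) := (b < a) && (a < c).
Definition is231 (a b c : nat) := (c < a) && (a < b).
Definition is312 (a b c : nat) := (b < c) && (c < a).

Lemma words_S3E :
  (((word p123 = [:: 1; 2; 3]) * (word p132 = [:: 1; 3; 2]) * (word p213 = [:: 2; 1; 3])) *
   ((word p231 = [:: 2; 3; 1]) * (word p312 = [:: 3; 1; 2]) * (word p321 = [:: 3; 2; 1])))%type.
Proof. by case: words_S3 => -[-> -> -> ->] [-> ->]. Qed.

Local Ltac solve_pattern a b c :=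
  rewrite words_S3E /red /= !eqseq_cons !ltnn !andbT
          ?/is123 ?/is132 ?/is213 ?/is231 ?/is312 ?/is321;
  case: (ltngtP a b); case: (ltngtP b c); case: (ltngtP a c) => //=; lia.

Lemma avoids_p123 n (s : 'S_n) : avoids s p123 = avoids3 is123 s.
Proof. by apply: avoids_avoids3 => a b c; solve_pattern a b c. Qed.
Lemma avoids_p132 n (s : 'S_n) : avoids s p132 = avoids3 is132 s.
Proof. by apply: avoids_avoids3 => a b c; solve_pattern a b c. Qed.
Lemma avoids_p213 n (s : 'S_n) : avoids s p213 = avoids3 is213 s.
Proof. by apply: avoids_avoids3 => a b c; solve_pattern a b c. Qed.
Lemma avoids_p231 n (s : 'S_n) : avoids s p231 = avoids3 is231 s.
Proof. by apply: avoids_avoids3 => a b c; solve_pattern a b c. Qed.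
Lemma avoids_p312 n (s : 'S_n) : avoids s p312 = avoids3 is312 s.
Proof. by apply: avoids_avoids3 => a b c; solve_pattern a b c. Qed.
Lemma avoids_p321 n (s : 'S_n) : avoids s p321 = avoids3 is321 s.
Proof. by apply: avoids_avoids3 => a b c; solve_pattern a b c. Qed.

(* Reverse-complement-inverse. *)
Definition rci n (s : 'S_n) : 'S_n :=
  (perm (@rev_ord_inj n) * s^-1 * perm (@rev_ord_inj n))%g.

Lemma rciE n (s : 'S_n) i : rci s i = rev_ord (s^-1 (rev_ord i))%g.
Proof. by rewrite !permM !permE. Qed.

Lemma rci_rev n (s : 'S_n) i : rci s (rev_ord (s i)) = rev_ord i.
Proof. by rewrite rciE rev_ordK permK. Qed.

Lemma rci_inj n : injective (@rci n).
Proof. by move=> s t /mulIg/mulgI/invg_inj. Qed.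

Lemma reindex_rev n (s : 'S_n) (F : 'I_n -> nat) : \sum_i F i = \sum_i F (rev_ord (s i)).
Proof. by rewrite (reindex_inj (inj_comp (@rev_ord_inj n) (@perm_inj _ s))). Qed.

(** The arc diagram is reflected: upper arcs stay upper and lower arcs lower, while the two arcs of
    a crossing change order. *)
Lemma crs_rci n (s : 'S_n) : crs (rci s) = crs s.
Proof.
rewrite /crs !card_pairE [RHS]exchange_big (reindex_rev s) /=.
apply: eq_bigr => i _; rewrite (reindex_rev s); apply: eq_bigr => j _.
rewrite /crossing !rci_rev /=.
by have := ltn_ord i; have := ltn_ord j; have := ltn_ord (s i); have := ltn_ord (s j); lia.
Qed.

Lemma nes_rci n (s : 'S_n) : nes (rci s) = nes s.
Proof.
rewrite /nes !card_pairE (reindex_rev s).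
apply: eq_bigr => i _; rewrite (reindex_rev s); apply: eq_bigr => j _.
rewrite /nesting !rci_rev /=.
by have := ltn_ord i; have := ltn_ord j; have := ltn_ord (s i); have := ltn_ord (s j); lia.
Qed.

(** 132 is an involution whose reverse complement is 213. *)
Lemma avoids3_rci n (s : 'S_n) : avoids3 is213 (rci s) = avoids3 is132 s.
Proof.
apply/avoids3P/avoids3P => H i j k lt_ij lt_jk; apply/negP => bad.
  have := H (rev_ord (s j)) (rev_ord (s k)) (rev_ord (s i)); rewrite !rci_rev.
  rewrite /is132 in bad; rewrite /is213 /=.
  by have := ltn_ord k; have := ltn_ord (s j); lia.
have := H (s^-1 (rev_ord k))%g (s^-1 (rev_ord i))%g (s^-1 (rev_ord j))%g.
rewrite !permKV /is132; move: bad; rewrite !rciE /is213 /=.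
have := ltn_ord (s^-1 (rev_ord k))%g; have := ltn_ord (s^-1 (rev_ord i))%g.
by have := ltn_ord (s^-1 (rev_ord j))%g; have := ltn_ord k; lia.
Qed.

Lemma avoids3V n (s : 'S_n) : avoids3 is312 s^-1%g = avoids3 is231 s.
Proof.
apply/avoids3P/avoids3P => H i j k lt_ij lt_jk; apply/negP => bad.
  have := H (s k) (s i) (s j); rewrite !permK.
  by rewrite /is231 in bad; rewrite /is312; lia.
have := H (s^-1 j)%g (s^-1 k)%g (s^-1 i)%g; rewrite !permKV.
by rewrite /is312 in bad; rewrite /is231; lia.
Qed.

(** As many positions as values are below $k$; cancelling the $i$ with both $i$ and $s(i)$ below $k$
    leaves the two sides. *)
Lemma nested_fixpoint n (s : 'S_n) (k : 'I_n) : s k = k ->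
  \sum_(i < n) ((i < k) && (k < s i)) = \sum_(i < n) ((k < i) && (s i < k)).
Proof.
move=> sk; have e : \sum_(i < n) (i < k) = \sum_(i < n) (s i < k).
  by rewrite (reindex_inj (@perm_inj _ s)).
apply/eqP; rewrite -(eqn_add2r (\sum_(i < n) (s i < k))) -{2}e -!big_split /=; apply/eqP.
apply: eq_bigr => i _; have [/val_inj->|ne] := eqVneq (i : nat) k; first by rewrite sk; lia.
by have := perm_val_neq s (negbTE ne); rewrite sk; lia.
Qed.

(** Inversion exchanges upper and lower arcs. A fixed point counts as nested under lower arcs only,
    and by [nested_fixpoint] it lies under equally many arcs of either kind. *)
Lemma nesV n (s : 'S_n) : nes s^-1%g = nes s.
Proof.
rewrite /nes !card_pairE (reindex_inj (@perm_inj _ s)).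
under eq_bigr => i _ do rewrite (reindex_inj (@perm_inj _ s)).
rewrite exchange_big /=.
have e : \sum_(i < n) \sum_(j < n) [&& i < j, s j == j & s j < s i] =
         \sum_(i < n) \sum_(j < n) [&& s j < s i, s i == i & i < j].
  rewrite exchange_big; apply: eq_bigr => k _.
  have [sk|_] := eqVneq (s k) k; last by rewrite !big1 // => i _; rewrite andbF.
  rewrite sk; under eq_bigr => i _ do rewrite andTb.
  by rewrite nested_fixpoint //; apply: eq_bigr => i _; rewrite andbC.
apply/eqP; rewrite -(eqn_add2r (\sum_(i < n) \sum_(j < n) [&& i < j, s j == j & s j < s i])).
rewrite {1}e -!big_split /=; apply/eqP; apply: eq_bigr => i _; rewrite -!big_split.
by apply: eq_bigr => j _; rewrite /nesting !permK -!val_eqE /=; lia.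
Qed.

(** * Wilf equivalence *)

Lemma mem_Av1 n k (t : 'S_k) (s : 'S_n) : (s \in Av n [:: Pattern t]) = avoids s t.
Proof. by rewrite inE /= andbT. Qed.

Lemma genpoly_reindex m (st : m.-tuple statistic) n (t u : 'S_3) (f : 'S_n -> 'S_n) :
  injective f -> (forall s, avoids (f s) u = avoids s t) ->
  (forall i s, tnth st i n (f s) = tnth st i n s) ->
  genpoly st n [:: Pattern t] = genpoly st n [:: Pattern u].
Proof.
move=> f_inj f_av f_st; rewrite /genpoly [RHS](reindex_inj f_inj) /=.
apply: eq_big => s; first by rewrite !mem_Av1 f_av.
by move=> _; apply: eq_bigr => i _; rewrite f_st.
Qed.

Lemma wilf_equiv_132_213 m (st : m.-tuple statistic) :
  (forall i n (s : 'S_n), tnth st i n (rci s) = tnth st i n s) ->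
  wilf_equiv st [:: Pattern p132] [:: Pattern p213].
Proof.
move=> st_rci n _; apply: (genpoly_reindex (@rci_inj n)) => // s.
by rewrite avoids_p132 avoids_p213 avoids3_rci.
Qed.

Lemma wilf_equiv_nes_231_312 : wilf_equiv [tuple nes] [:: Pattern p231] [:: Pattern p312].
Proof.
move=> n _; apply: (genpoly_reindex (@invg_inj 'S_n)) => s.
  by rewrite avoids_p231 avoids_p312 avoids3V.
by move=> s'; rewrite (tnth_nth (@nes)) ord1 /= nesV.
Qed.

Lemma wilf_equiv_crs_132_321 : wilf_equiv [tuple crs] [:: Pattern p132] [:: Pattern p321].
Proof.
move=> n _.
(* [crs_132_321] takes functions on integers; the absolute value turns the argument back into an
   exponent. *)
have E t : genpoly [tuple crs] n [:: Pattern t] =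
    (\sum_(s : 'S_n | avoids s t) (fun w : int => 'X_ord0 ^+ `|w|%N) (crs s))%R.
  apply: eq_big => s; first exact: mem_Av1.
  by rewrite big_ord1 (tnth_nth (@crs)).
rewrite !E (eq_bigl _ _ (@avoids_p132 n)) [RHS](eq_bigl _ _ (@avoids_p321 n)).
exact: (crs_132_321 _ (fun w : int => 'X_ord0 ^+ `|w|%N)%R).
Qed.

(* Value at X_i = i + 2 of the generating polynomial of S_4(t): these arguments
   tell all the inequivalent patterns apart. *)
Definition sig4 m (st : m.-tuple statistic) (t : 'S_3) : nat :=
  \sum_(s : 'S_4 | avoids s t) \prod_(i < m) (i + 2) ^ tnth st i 4 s.

Lemma wilf_equiv_sig4 m (st : m.-tuple statistic) (t u : 'S_3) :
  wilf_equiv st [:: Pattern t] [:: Pattern u] -> sig4 st t = sig4 st u.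
Proof.
move=> /(_ 4 isT)/(congr1 (meval (fun i : 'I_m => (i + 2)%:R : int)%R)).
have E v : ((genpoly st 4 [:: Pattern v]).@[fun i : 'I_m => (i + 2)%:R : int] = (sig4 st v)%:R)%R.
  rewrite rmorph_sum natr_sum; apply: eq_big => s; first exact: mem_Av1.
  by move=> _; rewrite rmorph_prod natr_prod; apply: eq_bigr => i _; rewrite rmorphXn natrX /= mevalXU.
by rewrite !E => /eqP; rewrite eqr_nat => /eqP.
Qed.

(** * Evaluation over $S_4$ by computation on lists of values *)

Definition valseq n (s : 'S_n) : seq nat := [seq val (s i) | i <- enum 'I_n].

Lemma nth_valseq n (s : 'S_n) (i : 'I_n) : nth 0 (valseq s) i = s i.
Proof. by rewrite (nth_map i) ?size_enum_ord // nth_ord_enum. Qed.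

(** Both lists are duplicate-free, the first is contained in the second, and both have $n!$
    entries. *)
Lemma valseq_permutations n :
  perm_eq [seq valseq s | s <- index_enum {perm 'I_n}] (permutations (iota 0 n)).
Proof.
have u1 : uniq [seq valseq s | s <- index_enum {perm 'I_n}].
  rewrite map_inj_uniq ?index_enum_uniq // => s t e; apply/permP => i.
  by apply: val_inj; rewrite /= -!nth_valseq e.
apply: uniq_perm => //; first exact: permutations_uniq.
have sub : {subset [seq valseq s | s <- index_enum {perm 'I_n}] <= permutations (iota 0 n)}.
  move=> w /mapP[s _ ->]; rewrite mem_permutations perm_sym; apply: uniq_perm.
  - by rewrite iota_uniq.
  - by rewrite map_inj_uniq ?enum_uniq // => i j /val_inj/perm_inj.
  move=> k; rewrite mem_iota /= add0n; apply/idP/mapP => [lt_kn|[i _ ->]]; last exact: ltn_ord.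
  by exists (s^-1 (Ordinal lt_kn))%g; rewrite ?mem_enum // permKV.
apply: (uniq_min_size u1 sub _).2.
rewrite size_permutations ?iota_uniq // size_iota size_map.
by rewrite [index_enum _]unlock -enumT -cardT card_Sn.
Qed.

Lemma sum_valseq n (P : pred (seq nat)) (F : seq nat -> nat) :
  \sum_(s : 'S_n | P (valseq s)) F (valseq s) =
  sumn [seq F w | w <- permutations (iota 0 n) & P w].
Proof.
by rewrite sumnE big_map big_filter -(perm_big _ (valseq_permutations n)) big_map.
Qed.

Lemma sum_ord_sumn n (F : nat -> nat) : \sum_(i < n) F i = sumn [seq F i | i <- iota 0 n].
Proof. by rewrite sumnE big_map -(big_mkord xpredT F) /index_iota subn0. Qed.

Definition pairsum n (c : nat -> nat -> nat -> nat -> bool) (w : seq nat) : nat :=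
  sumn [seq sumn [seq nat_of_bool (c i j (nth 0 w i) (nth 0 w j)) | j <- iota 0 n] | i <- iota 0 n].

Lemma pairsumE n (c : nat -> nat -> nat -> nat -> bool) (s : 'S_n) :
  \sum_(i < n) \sum_(j < n) c i j (s i) (s j) = pairsum n c (valseq s).
Proof.
rewrite /pairsum -sum_ord_sumn; apply: eq_bigr => i _.
by rewrite -sum_ord_sumn; apply: eq_bigr => j _; rewrite !nth_valseq.
Qed.

Definition crsw n := pairsum n (fun i j a b =>
  [&& i < j, j < a & a < b] || [&& a < b, b <= i & i < j]).
Definition nesw n := pairsum n (fun i j a b =>
  [&& i < j, j < b & b < a] || [&& b < a, a <= i & i < j]).

Lemma crs_valseq n (s : 'S_n) : crs s = crsw n (valseq s).
Proof. by rewrite /crs card_pairE /crsw -pairsumE. Qed.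

Lemma nes_valseq n (s : 'S_n) : nes s = nesw n (valseq s).
Proof. by rewrite /nes card_pairE /nesw -pairsumE. Qed.

Definition avoids3w n (Q : nat -> nat -> nat -> bool) (w : seq nat) : bool :=
  all (fun i => all (fun j => all (fun k =>
    (i < j) && (j < k) ==> ~~ Q (nth 0 w i) (nth 0 w j) (nth 0 w k))
    (iota 0 n)) (iota 0 n)) (iota 0 n).

Lemma all_iota_ord n (p : pred nat) : all p (iota 0 n) = [forall i : 'I_n, p i].
Proof.
apply/allP/forallP => [H i|H k]; first by apply: H; rewrite mem_iota /=.
by rewrite mem_iota /= add0n => lt_kn; have := H (Ordinal lt_kn).
Qed.

Lemma avoids3_valseq n Q (s : 'S_n) : avoids3 Q s = avoids3w n Q (valseq s).
Proof.
rewrite /avoids3w all_iota_ord; apply: eq_forallb => i.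
rewrite all_iota_ord; apply: eq_forallb => j.
by rewrite all_iota_ord; apply: eq_forallb => k; rewrite !nth_valseq.
Qed.

Definition patterns3 : seq 'S_3 := [:: p123; p132; p213; p231; p312; p321].

Lemma sig4E m (st : m.-tuple statistic) (g : seq nat -> nat) :
  (forall s : 'S_4, \prod_(i < m) (i + 2) ^ tnth st i 4 s = g (valseq s)) ->
  [seq sig4 st t | t <- patterns3] =
  [seq sumn [seq g w | w <- permutations (iota 0 4) & avoids3w 4 Q w]
     | Q <- [:: is123; is132; is213; is231; is312; is321]].
Proof.
move=> stE.
have E t Q : (forall s : 'S_4, avoids s t = avoids3 Q s) ->
    sig4 st t = sumn [seq g w | w <- permutations (iota 0 4) & avoids3w 4 Q w].
  by move=> avE; rewrite -sum_valseq; apply: eq_big => s; rewrite ?avE ?avoids3_valseq.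
congr [:: _; _; _; _; _; _]; apply: E; [exact: avoids_p123 | exact: avoids_p132
  | exact: avoids_p213 | exact: avoids_p231 | exact: avoids_p312 | exact: avoids_p321].
Qed.

Lemma sig4_nes : [seq sig4 [tuple nes] t | t <- patterns3] = [:: 28; 25; 25; 22; 22; 14].
Proof.
rewrite (@sig4E _ _ (fun w => 2 ^ nesw 4 w)); first by vm_compute.
by move=> s; rewrite big_ord1 -nes_valseq.
Qed.

Lemma sig4_crs : [seq sig4 [tuple crs] t | t <- patterns3] = [:: 23; 24; 24; 22; 15; 24].
Proof.
rewrite (@sig4E _ _ (fun w => 2 ^ crsw 4 w)); first by vm_compute.
by move=> s; rewrite big_ord1 -crs_valseq.
Qed.

Lemma sig4_crs_nes :
  [seq sig4 [tuple crs; nes] t | t <- patterns3] = [:: 63; 56; 56; 46; 35; 24].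
Proof.
rewrite (@sig4E _ _ (fun w => 2 ^ crsw 4 w * 3 ^ nesw 4 w)); first by vm_compute.
by move=> s; rewrite big_ord_recr big_ord1 -crs_valseq -nes_valseq.
Qed.

(** * Signatures and equivalence classes *)

Lemma word_inj n : injective (@word n).
Proof.
move=> s t e; apply/permP => i; apply: val_inj; apply: succn_inj.
have : nth 0 (word s) i = nth 0 (word t) i by rewrite e.
by rewrite !(nth_map i) -?enumT ?size_enum_ord // nth_ord_enum.
Qed.

Lemma eq_patterns3 (s t : 'S_3) : (s == t) = (word s == word t).
Proof. by rewrite (inj_eq (@word_inj 3)). Qed.

Lemma mem_patterns3 t : t \in patterns3.
Proof.
have u : uniq patterns3 by rewrite -(map_inj_uniq (@word_inj 3)) /= !words_S3E.
have sub : {subset patterns3 <= enum 'S_3} by move=> s _; rewrite mem_enum.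
by rewrite (uniq_min_size u sub _).2 ?mem_enum // -cardE card_Sn.
Qed.

Lemma patterns3_ind (P : 'S_3 -> Prop) :
  P p123 -> P p132 -> P p213 -> P p231 -> P p312 -> P p321 -> forall t, P t.
Proof.
move=> P1 P2 P3 P4 P5 P6 t; have := mem_patterns3 t.
by rewrite !inE; do 5?[case/orP => [/eqP->//|]]; move/eqP->.
Qed.

(** Once [c] is a complete invariant of the equivalence, the classes are its fibres. *)
Lemma is_wilf_classP m (st : m.-tuple statistic) (c : 'S_3 -> nat) (C : {set 'S_3}) :
  (forall t u, wilf_equiv st [:: Pattern t] [:: Pattern u] <-> c t = c u) ->
  is_wilf_class st C <-> exists t, C = [set u | c u == c t].
Proof.
move=> cP; split=> -[t tP]; exists t.
  by apply/setP => u; rewrite inE; apply/idP/eqP => [/tP/cP//|e]; apply/tP/cP.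
by move=> u; rewrite tP inE cP; split=> [/eqP//|->].
Qed.

Lemma wilf_equiv_sym m (st : m.-tuple statistic) T U : wilf_equiv st T U -> wilf_equiv st U T.
Proof. by move=> e n n0; rewrite e. Qed.

Lemma wilf_equiv_trans m (st : m.-tuple statistic) T U W :
  wilf_equiv st T U -> wilf_equiv st U W -> wilf_equiv st T W.
Proof. by move=> e f n n0; rewrite e ?f. Qed.

(** The only coincidences among the computed signatures are those of 132 with 213 and of 231 with
    312, and both come from bijections. *)
Lemma wilf_nes t u :
  wilf_equiv [tuple nes] [:: Pattern t] [:: Pattern u] <->
  sig4 [tuple nes] t = sig4 [tuple nes] u.
Proof.
split; first exact: wilf_equiv_sig4.
have := sig4_nes; case=> e1 e2 e3 e4 e5 e6.
have E1 : wilf_equiv [tuple nes] [:: Pattern p132] [:: Pattern p213].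
  by apply: wilf_equiv_132_213 => i n s; rewrite (tnth_nth (@nes)) ord1 /= nes_rci.
have E2 := wilf_equiv_nes_231_312.
have E1' := wilf_equiv_sym E1; have E2' := wilf_equiv_sym E2.
by elim/patterns3_ind: t; elim/patterns3_ind: u; rewrite ?(e1, e2, e3, e4, e5, e6).
Qed.

Lemma wilf_crs t u :
  wilf_equiv [tuple crs] [:: Pattern t] [:: Pattern u] <->
  sig4 [tuple crs] t = sig4 [tuple crs] u.
Proof.
split; first exact: wilf_equiv_sig4.
have := sig4_crs; case=> e1 e2 e3 e4 e5 e6.
have E1 : wilf_equiv [tuple crs] [:: Pattern p132] [:: Pattern p213].
  by apply: wilf_equiv_132_213 => i n s; rewrite (tnth_nth (@crs)) ord1 /= crs_rci.
have E2 := wilf_equiv_crs_132_321.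
have E1' := wilf_equiv_sym E1; have E2' := wilf_equiv_sym E2.
(* 213 and 321 are linked through 132. *)
have E3 := wilf_equiv_trans E1' E2; have E3' := wilf_equiv_sym E3.
by elim/patterns3_ind: t; elim/patterns3_ind: u; rewrite ?(e1, e2, e3, e4, e5, e6).
Qed.

Lemma wilf_crs_nes t u :
  wilf_equiv [tuple crs; nes] [:: Pattern t] [:: Pattern u] <->
  sig4 [tuple crs; nes] t = sig4 [tuple crs; nes] u.
Proof.
split; first exact: wilf_equiv_sig4.
have := sig4_crs_nes; case=> e1 e2 e3 e4 e5 e6.
have E1 : wilf_equiv [tuple crs; nes] [:: Pattern p132] [:: Pattern p213].
  apply: wilf_equiv_132_213 => i n s; rewrite (tnth_nth (@nes)).
  by case: i => -[|[|i]] //= _; rewrite ?crs_rci ?nes_rci.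
have E1' := wilf_equiv_sym E1.
by elim/patterns3_ind: t; elim/patterns3_ind: u; rewrite ?(e1, e2, e3, e4, e5, e6).
Qed.

Lemma nes_classE t :
  [set u | sig4 [tuple nes] u == sig4 [tuple nes] t] =
  if t \in [set p132; p213] then [set p132; p213]
  else if t \in [set p231; p312] then [set p231; p312] else [set t].
Proof.
have := sig4_nes; case=> e1 e2 e3 e4 e5 e6.
elim/patterns3_ind: t; rewrite !inE !eq_patterns3 !words_S3E /=;
  apply/setP; elim/patterns3_ind;
  by rewrite !inE !eq_patterns3 !words_S3E ?(e1, e2, e3, e4, e5, e6).
Qed.

Lemma crs_classE t :
  [set u | sig4 [tuple crs] u == sig4 [tuple crs] t] =
  if t \in [set p132; p213; p321] then [set p132; p213; p321] else [set t].
Proof.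
have := sig4_crs; case=> e1 e2 e3 e4 e5 e6.
elim/patterns3_ind: t; rewrite !inE !eq_patterns3 !words_S3E /=;
  apply/setP; elim/patterns3_ind;
  by rewrite !inE !eq_patterns3 !words_S3E ?(e1, e2, e3, e4, e5, e6).
Qed.

Lemma crs_nes_classE t :
  [set u | sig4 [tuple crs; nes] u == sig4 [tuple crs; nes] t] =
  if t \in [set p132; p213] then [set p132; p213] else [set t].
Proof.
have := sig4_crs_nes; case=> e1 e2 e3 e4 e5 e6.
elim/patterns3_ind: t; rewrite !inE !eq_patterns3 !words_S3E /=;
  apply/setP; elim/patterns3_ind;
  by rewrite !inE !eq_patterns3 !words_S3E ?(e1, e2, e3, e4, e5, e6).
Qed.

Theorem theorem1p1 :
  [/\ (forall C : {set 'S_3},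
         is_wilf_class [tuple nes] C /\ 1 < #|C| <->
         C = [set p132; p213] \/ C = [set p231; p312])
      /\ (forall t : 'S_3,
            t \notin [set p132; p213] -> t \notin [set p231; p312] ->
            is_wilf_class [tuple nes] [set t]),
      (forall C : {set 'S_3},
         is_wilf_class [tuple crs] C /\ 1 < #|C| <->
         C = [set p132; p213; p321])
    & (forall C : {set 'S_3},
         is_wilf_class [tuple crs; nes] C /\ 1 < #|C| <->
         C = [set p132; p213])].
Proof.
have ne1 : p132 != p213 by rewrite eq_patterns3 !words_S3E.
have ne2 : p231 != p312 by rewrite eq_patterns3 !words_S3E.
split; first split.
- move=> C; rewrite (is_wilf_classP C wilf_nes); split.
    case=> -[t ->]; rewrite nes_classE; case: ifP => _; first by left.
    by case: ifP => _; [right|rewrite cards1].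
  case=> ->; (split; last by rewrite cards2 ?ne1 ?ne2).
    by exists p132; rewrite nes_classE set21.
  (* The first test of [nes_classE] has to fail before the second is reached. *)
  exists p231; rewrite nes_classE set21 ifF //.
  by rewrite !inE !eq_patterns3 !words_S3E.
- move=> t /negbTE t1 /negbTE t2; apply/(is_wilf_classP _ wilf_nes).
  by exists t; rewrite nes_classE t1 t2.
- move=> C; rewrite (is_wilf_classP C wilf_crs); split.
    by case=> -[t ->]; rewrite crs_classE; case: ifP => // _; rewrite cards1.
  move=> ->; split; first by exists p132; rewrite crs_classE !inE eqxx.
  by apply/card_gt1P; exists p132, p213; rewrite !inE !eqxx ?orbT.
- move=> C; rewrite (is_wilf_classP C wilf_crs_nes); split.
    by case=> -[t ->]; rewrite crs_nes_classE; case: ifP => // _; rewrite cards1.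
  move=> ->; split; last by rewrite cards2 ne1.
  by exists p132; rewrite crs_nes_classE set21.
Qed.
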